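(* Let $m\ge 0$ be an integer, let $P_0,\dots,P_m\in\mathbb{R}[x]$ be real polynomials with $P_m\not\equiv 0$, and consider the planar polynomial Newton system $$\dot x=y,\qquad \dot y=P_0(x)+P_1(x)y+\cdots+P_m(x)y^m .$$ If this system is monodromic at infinity, then $m\le 2$.
   Context: A planar polynomial differential system is called monodromic at infinity if, in its Poincaré compactification (the extension of the system to the Poincaré sphere, whose equator represents the infinity of $\mathbb{R}^2$), no orbits of the system in $\mathbb{R}^2$ connect with (i.e. tend, in forward or backward time, to) any equilibrium on the equator of the Poincaré sphere. *)

(* Defs.v *)
From HB Require Import structures.
From mathcomp Require Import all_boot all_order all_algebra.
From mathcomp Require Import ring.
From mathcomp Require Import all_classical all_reals all_analysis.

Set Implicit Arguments.
Unset Strict Implicit.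
Unset Printing Implicit Defensive.

Import Order.TTheory GRing.Theory Num.Theory.
Import numFieldNormedType.Exports.

Local Open Scope classical_set_scope.
Local Open Scope ring_scope.

(* A real polynomial in (x, y) is an element of {poly {poly R}} whose outer
   variable is y and whose coefficients are polynomials in x, so that p`_j`_i
   is the coefficient of x^i y^j. *)

Definition eval2 (R : realType) (p : {poly {poly R}}) (x y : R) : R :=
  p.[y%:P].[x].

Definition total_degree (R : realType) (p : {poly {poly R}}) : nat :=
  \max_(j < size p | p`_j != 0) (j + (size (p`_j)%R).-1)%N.

Definition system_degree (R : realType) (P Q : {poly {poly R}}) : nat :=
  maxn (total_degree P) (total_degree Q).

(* z3^d p(z1/z3, z2/z3) as a polynomial in z1, z2, z3, for d at least the total
   degree of p; see homogenizeE. *)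
Definition homogenize (R : realType) (d : nat) (p : {poly {poly R}})
    (z1 z2 z3 : R) : R :=
  \sum_(j < size p) \sum_(i < size p`_j)
    p`_j`_i * z1 ^+ i * z2 ^+ j * z3 ^+ (d - (i + j)).

Lemma homogenizeE (R : realType) (d : nat) (p : {poly {poly R}})
    (z1 z2 z3 : R) : (total_degree p <= d)%N -> z3 != 0 ->
  homogenize d p z1 z2 z3 = z3 ^+ d * eval2 p (z1 / z3) (z2 / z3).
Proof.
move=> pd z30; rewrite /eval2 (horner_coef p) horner_sum mulr_sumr.
apply: eq_bigr => j _.
rewrite -polyC_exp hornerM hornerC horner_coef mulr_suml mulr_sumr.
apply: eq_bigr => i _.
have pj0 : p`_j != 0 by apply/eqP => p0; case: i => i; rewrite p0 size_poly0.
have ij : (i + j <= d)%N.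
  apply: leq_trans pd; rewrite /total_degree.
  have := @leq_bigmax_cond _ (fun j : 'I_(size p) => p`_j != 0)
    (fun j : 'I_(size p) => (j + (size (p`_j)%R).-1)%N) j pj0.
  apply: leq_trans.
  by rewrite addnC leq_add2l -ltnS prednK // size_poly_gt0.
rewrite -{2}(subnK ij) !exprMn !exprVn !exprD.
have zi : z3 ^+ i != 0 by rewrite expf_neq0.
have zj : z3 ^+ j != 0 by rewrite expf_neq0.
by move: zi zj; set a := z3 ^+ i; set b := z3 ^+ j => zi zj; field; rewrite zi zj.
Qed.

(* Central projection of the plane {z3 = 1} onto the open northern hemisphere. *)
Definition poincare_proj (R : realType) (x y : R) : R * R * R :=
  let D := Num.sqrt (1 + x ^+ 2 + y ^+ 2) in (x / D, y / D, 1 / D).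

(* Poincare compactification of x' = P(x, y), y' = Q(x, y): with d the degree of
   the system, the push-forward of (P, Q) under poincare_proj, multiplied by
   z3 ^ (d - 1), equals the expression below on the open northern hemisphere;
   being polynomial, it extends to the whole sphere. *)
Definition poincare_field (R : realType) (P Q : {poly {poly R}})
    (z : R * R * R) : R * R * R :=
  let: (z1, z2, z3) := z in
  let d := system_degree P Q in
  let p := homogenize d P z1 z2 z3 in
  let q := homogenize d Q z1 z2 z3 in
  ((1 - z1 ^+ 2) * p - z1 * z2 * q,
   (1 - z2 ^+ 2) * q - z1 * z2 * p,
   - z3 * (z1 * p + z2 * q)).

Definition equator (R : realType) : set (R * R * R) :=
  [set z | z.1.1 ^+ 2 + z.1.2 ^+ 2 = 1 /\ z.2 = 0].

Definition equilibrium_at_infinity (R : realType) (P Q : {poly {poly R}})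
    (z : R * R * R) : Prop :=
  equator z /\ poincare_field P Q z = (0, 0, 0).

Definition solution (R : realType) (P Q : {poly {poly R}})
    (I : set R) (x y : R -> R) : Prop :=
  [/\ I !=set0, open I, is_interval I &
    forall t, I t -> is_derive t 1 x (eval2 P (x t) (y t)) /\
                     is_derive t 1 y (eval2 Q (x t) (y t))].

(* Orbits are the images of maximal solutions; I may be unbounded. *)
Definition maximal_solution (R : realType) (P Q : {poly {poly R}})
    (I : set R) (x y : R -> R) : Prop :=
  solution P Q I x y /\
  forall (J : set R) (u v : R -> R), solution P Q J u v -> I `<=` J ->
    (forall t, I t -> u t = x t /\ v t = y t) -> J `<=` I.

(* The filters of t tending, inside the open interval I, to sup I and to inf I,
   whether these are finite or not. *)
Definition forward_end (R : realType) (I : set R) : set_system R :=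
  [set A | exists2 s, I s & forall t, I t -> s < t -> A t].

Definition backward_end (R : realType) (I : set R) : set_system R :=
  [set A | exists2 s, I s & forall t, I t -> t < s -> A t].

Definition monodromic_at_infinity (R : realType) (P Q : {poly {poly R}}) : Prop :=
  forall (I : set R) (x y : R -> R) (z : R * R * R),
    maximal_solution P Q I x y -> equilibrium_at_infinity P Q z ->
    ~ ((fun t => poincare_proj (x t) (y t)) @ forward_end I --> z) /\
    ~ ((fun t => poincare_proj (x t) (y t)) @ backward_end I --> z).

(* Main.v *)
Require Import Defs.
From HB Require Import structures.
From mathcomp Require Import all_boot all_order all_algebra.
From mathcomp Require Import ring lra.
From mathcomp Require Import all_classical all_reals all_analysis.

Set Implicit Arguments.
Unset Strict Implicit.
Unset Printing Implicit Defensive.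

Import Order.TTheory GRing.Theory Num.Theory.
Import numFieldNormedType.Exports.

Local Open Scope classical_set_scope.
Local Open Scope ring_scope.

(** Near a point where the leading coefficient [P_m] does not vanish and for large
    [y], the equation for [y] behaves like [y' = c * y ^ m]. If [m >= 3], then
    [dx / dy] is of order [y ^ (1 - m)], which is integrable at infinity: [y] blows
    up in finite time, forward or backward according to the sign of [c], while [x]
    has a finite limit. Such an orbit tends in the Poincare compactification to
    the end [(0, 1, 0)] of the [y]-axis, which is always an equilibrium on the
    equator because the degree of the system is at least [2]
    ([newton_equilibrium]). Hence the system is not monodromic at infinity.

    To construct the orbit, put [w = 1 / y] and rescale time. The orbits become
    those of a polynomial vector field which is regular at [w = 0] exactly when
    [m >= 3], and transverse to [w = 0] at every [a] with [P_m(a)] nonzero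
    ([newton_chart_flow]); the trajectory through [(a, 0)] exists by the
    Picard-Lindelof theorem ([picard_lindelof_local]). The original time is
    carried along as a third coordinate, and inverting it
    ([increasing_inverse]) turns the part [w > 0] of the trajectory into a
    solution of the Newton system ([time_change_solution]).

    Orbits are images of maximal solutions. A maximal extension of the solution
    just found exists by Zorn's lemma ([maximal_extension]); it cannot be continued
    through the blow-up time, since [y] would be continuous there, so it still
    tends to [(0, 1, 0)] ([newton_vertical_blowup]). *)

(** * Antiderivatives of continuous functions *)

Lemma derive_bounded_lipschitz (R : realType) (F : R -> R) (A : interval R)
    (dF : R -> R) (K : R) :
  (forall x, x \in A -> is_derive x 1 F (dF x)) ->
  (forall x, x \in A -> `|dF x| <= K) ->
  forall x y, x \in A -> y \in A -> `|F x - F y| <= K * `|x - y|.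
Proof.
move=> FdF dFK x y.
wlog xy : x y / x <= y => [H xA yA|xA yA].
  have [/H|/ltW /H] := leP x y; first exact.
  by rewrite distrC (distrC x); apply.
have xyA z : z \in `[x, y] -> z \in A.
  rewrite in_itv /= => /andP[xz zy].
  have := @interval_is_interval R A x y xA yA z.
  by apply; rewrite xz zy.
have [| |c cxy FE] := @MVT_segment R F dF x y xy.
- by move=> z zxy; apply/FdF/xyA; apply: subset_itv_oo_cc zxy.
- apply: derivable_within_continuous => z zxy.
  by have [] := FdF z (xyA z zxy).
rewrite distrC FE normrM (distrC x); apply: ler_wpM2r => //.
exact/dFK/xyA.
Qed.

(** The first fundamental theorem of calculus differentiates the integral only
    strictly inside its domain; starting the integral at [- N] puts [0] in the
    interior. *)
Lemma continuous_antiderivative_bounded (R : realType) (g : R -> R) (N : R) :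
  0 < N -> continuous g ->
  exists2 F : R -> R, F 0 = 0 &
    forall x : R, `|x| < N -> is_derive x 1 F (g x).
Proof.
move=> N0 cg.
pose F (y : R) := (\int[@lebesgue_measure R]_(t in `[- N, y]) g t)%R.
exists (fun y => F y - F 0) => [|x]; first by rewrite subrr.
rewrite ltr_norml => /andP[Nx xN].
have [||Fd FE] := @continuous_FTC1_closed R g (- N) x N xN _ Nx.
- apply: continuous_compact_integrable; first exact: segment_compact.
  exact: continuous_subspaceT.
- exact: cg.
have FdF : is_derive x 1 F (g x)
  by apply: DeriveDef; [exact: Fd|rewrite -derive1E; exact: FE].
by apply: is_derive_eq; rewrite subr0.
Qed.

(** Two antiderivatives that vanish at [0] agree on their common interval, so
    those obtained on the intervals of radius [n.+1] glue together. *)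
Lemma continuous_antiderivative (R : realType) (g : R -> R) : continuous g ->
  exists2 G : R -> R, G 0 = 0 & forall x : R, is_derive x 1 G (g x).
Proof.
move=> cg.
have /choice[F HF] n : exists F : R -> R,
    F 0 = 0 /\ forall x : R, `|x| < n.+1%:R -> is_derive x 1 F (g x).
  have [//|F F0 FD] := @continuous_antiderivative_bounded R g n.+1%:R _ cg.
  by exists F.
have F0 n : F n 0 = 0 by have [] := HF n.
have FD n (x : R) : `|x| < n.+1%:R -> is_derive x 1 (F n) (g x).
  by have [_] := HF n; apply.
have FE_le n k (x : R) : (n <= k)%N -> `|x| < n.+1%:R -> F n x = F k x.
  move=> nk xn.
  have FB (z : R) : z \in `](- n.+1%:R : R), n.+1%:R[ ->
      is_derive z 1 (F n \- F k) (g z - g z).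
    rewrite in_itv /= -ltr_norml => zn.
    have zk : `|z| < k.+1%:R by apply: lt_le_trans zn _; rewrite ler_nat.
    by have := FD _ _ zn; have := FD _ _ zk => ? ?; exact: is_deriveB.
  have := derive_bounded_lipschitz (K := 0) FB _ (x := x) (y := 0).
  rewrite !in_itv /= -!ltr_norml normr0 ltr0Sn xn /= !F0 subrr subr0 mul0r.
  move=> /(_ _ isT isT) H; apply/eqP; rewrite -subr_eq0 -normr_le0; apply: H.
  by move=> z _; rewrite subrr normr0.
have FE n k (x : R) : `|x| < n.+1%:R -> `|x| < k.+1%:R -> F n x = F k x.
  have [nk xn _|/ltnW kn _ xk] := leqP n k; first exact: FE_le.
  by apply/esym/FE_le.
pose B (x : R) := Num.bound `|x|.
have xB (x : R) : `|x| < (B x).+1%:R.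
  by apply: lt_trans (archi_boundP (normr_ge0 x)) _; rewrite ltr_nat.
exists (fun x => F (B x) x) => [|x]; first exact: F0.
have := FD _ _ (xB x); apply: near_eq_is_derive => //.
near=> z; apply: FE => //.
near: z; apply: (@cvgr_norm_lt _ _ _ (nbhs x) _ id x) => //.
Unshelve. all: by end_near. Qed.

(** * Existence of solutions of Lipschitz differential equations *)

(** A quadratic bound on the remainder is an inequality between values of [u],
    hence survives a pointwise limit of functions: this is how the limit of the
    Picard iterates is differentiated, without uniform convergence of the
    derivatives. *)
Lemma derive_quadratic_remainder (R : realType) (u : R -> R) (x l K d : R) :
  0 < d ->
  (forall z, `|z - x| < d -> `|u z - u x - (z - x) * l| <= K * `|z - x| ^+ 2) ->
  is_derive x 1 u l.
Proof.
move=> d0 H.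
suff ul : h^-1 *: (u (h *: 1 + x) - u x) @[h --> 0^'] --> l.
  by apply: DeriveDef; [apply/cvg_ex; exists l|exact/cvg_lim].
apply/cvgrPdist_le => e e0; near=> h.
have h0 : h != 0 by near: h; exact: nbhs_dnbhs_neq.
have hd : `|h| < d by near: h; apply: dnbhs0_lt.
have := H (h *: 1 + x); rewrite addrK [h *: 1]mulr1 => /(_ hd).
move: (u (h + x)) => w wl; rewrite distrC.
have -> : h^-1 *: (w - u x) - l = h^-1 * (w - u x - h * l).
  by rewrite [RHS]mulrBr mulrA mulVf // mul1r.
rewrite normrM normfV ler_pdivrMl ?normr_gt0//; apply: le_trans wl _.
rewrite expr2 mulrCA; apply: ler_wpM2l => //.
apply: (@le_trans _ _ ((`|K| + 1) * `|h|)).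
  by apply: ler_wpM2r => //; have := ler_norm K; lra.
have K1 : 0 < `|K| + 1 by rewrite ltr_wpDl.
rewrite mulrC -ler_pdivlMr //; near: h; apply: dnbhs0_le.
by rewrite divr_gt0.
Unshelve. all: by end_near. Qed.

Lemma lipschitz_continuous (R : realType) (g : R -> R) (K : R) :
  (forall x y, `|g x - g y| <= K * `|x - y|) -> continuous g.
Proof.
move=> gK x; apply/cvgrPdist_le => e e0; near=> y.
apply: le_trans (gK _ _) _.
have K1 : 0 < `|K| + 1 by rewrite ltr_wpDl.
apply: (@le_trans _ _ ((`|K| + 1) * `|x - y|)).
  by apply: ler_wpM2r => //; have := ler_norm K; lra.
rewrite mulrC -ler_pdivlMr //; near: y.
by apply: (@cvgr_dist_le _ _ _ (nbhs x) _ id x) => //; rewrite divr_gt0.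
Unshelve. all: by end_near. Qed.

(** The intervals of radius [2 * C / 2 ^+ n] around [v n] are nested, and the
    supremum of their left ends lies in all of them. *)
Lemma geometric_cauchy_limit (R : realType) (v : nat -> R) (C : R) :
  (forall n, `|v n.+1 - v n| <= C / 2 ^+ n) ->
  exists l, forall n, `|v n - l| <= 2 * C / 2 ^+ n.
Proof.
move=> vC; pose r n := 2 * C / 2 ^+ n.
have rS n : r n = r n.+1 + C / 2 ^+ n.
  by rewrite /r exprS; field; rewrite expf_neq0.
have r0 n : 0 <= r n.
  by rewrite /r -mulrA mulr_ge0 //; apply: le_trans (vC n).
have mono n k : v n - r n <= v (n + k)%N - r (n + k)%N /\
                v (n + k)%N + r (n + k)%N <= v n + r n.
  elim: k => [|k [IH1 IH2]]; first by rewrite addn0.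
  rewrite addnS; have := vC (n + k)%N; rewrite ler_norml (rS (n + k)%N) in IH1 IH2 *.
  by move=> /andP[? ?]; lra.
have bd n k : v k - r k <= v n + r n.
  have [nk|/ltnW kn] := leqP n k.
    by have [_] := mono n (k - n)%N; rewrite subnKC //; have := r0 k; lra.
  by have [+ _] := mono k (n - k)%N; rewrite subnKC //; have := r0 n; lra.
pose A := [set v k - r k | k in [set: nat]].
have A0 : A !=set0 by exists (v 0%N - r 0%N), 0%N.
have Ab n : ubound A (v n + r n) by move=> _ [k _ <-].
exists (sup A) => n; rewrite ler_norml.
have := ge_sup A0 (Ab n).
have : v n - r n <= sup A by apply: ub_le_sup; [exists (v 0%N + r 0%N)|exists n].
by rewrite -/(r n) => *; apply/andP; split; lra.
Qed.

Lemma le_geometric_limit (R : realType) (x y C : R) :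
  (forall n, x <= y + C / 2 ^+ n) -> x <= y.
Proof.
move=> H; rewrite leNgt; apply/negP => yx.
have xy : 0 < x - y by rewrite subr_gt0.
have := archi_boundP (normr_ge0 (C / (x - y))).
set n := Num.bound _ => Cn; have := H n; apply/negP; rewrite -ltNge.
rewrite -ltrBrDl ltr_pdivrMr ?exprn_gt0 // mulrC -ltr_pdivrMr //.
apply: le_lt_trans (ler_norm _) (lt_trans Cn _).
by rewrite -natrX ltr_nat ltn_expl.
Qed.

(** Picard iteration. The iterates are uniformly [M]-Lipschitz, and on an
    interval on which [L * h <= 1 / 2] two consecutive ones are within
    [M * h / 2 ^+ n] of each other, so they converge pointwise. At a point [s] the
    mean value theorem gives, for the iterate [n.+1], a remainder of at most
    [L * (M * `|z - s| + 2 * (M * h) / 2 ^+ n) * `|z - s|], which tends to a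
    quadratic one. The condition on [L] is the Lipschitz condition for the
    supremum distance, in a form that does not need this supremum to exist. *)
Lemma picard_lindelof (R : realType) (I : Type) (f : I -> (I -> R) -> R)
    (p : I -> R) (M L : R) : 0 <= M -> 0 <= L ->
  (forall i q, `|f i q| <= M) ->
  (forall q q' e, (forall j, `|q j - q' j| <= e) ->
     forall i, `|f i q - f i q'| <= L * e) ->
  exists2 h : R, 0 < h & exists u : I -> R -> R, (forall i, u i 0 = p i) /\
    forall i (s : R), `|s| < h -> is_derive s 1 (u i) (f i (u ^~ s)).
Proof.
move=> M0 L0 fM fL.
have /choice[A HA] (g : R -> R) : exists G : R -> R, continuous g ->
    G 0 = 0 /\ forall x : R, is_derive x 1 G (g x).
  have [cg|ncg] := pselect (continuous g); last by exists g.
  by have [G G0 GD] := continuous_antiderivative cg; exists G.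
pose step (v : I -> R -> R) i s := p i + A (fun r => f i (v ^~ r)) s.
pose u n := iter n step (fun i _ => p i).
have uS n i s : u n.+1 i s = p i + A (fun r => f i (u n ^~ r)) s by [].
have lip_cont n : (forall i s s', `|u n i s - u n i s'| <= M * `|s - s'|) ->
    forall i, continuous (fun r => f i (u n ^~ r)).
  move=> un i; apply: (@lipschitz_continuous _ _ (L * M)) => x y.
  by rewrite -mulrA; apply: fL => j; exact: un.
have lip_step n : (forall i s s', `|u n i s - u n i s'| <= M * `|s - s'|) ->
    u n.+1 ^~ 0 = p /\
    forall i (s : R), is_derive s 1 (u n.+1 i) (f i (u n ^~ s)).
  move=> /lip_cont un; split=> [|i s].
    by apply/funext => i; have [A0 _] := HA _ (un i); rewrite uS A0 addr0.
  have [_ /(_ s) AD] := HA _ (un i).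
  by rewrite -[X in is_derive _ _ _ X]add0r; apply: is_deriveD.
have lip n i s s' : `|u n i s - u n i s'| <= M * `|s - s'|.
  elim: n i s s' => [|n IH] i s s'; first by rewrite subrr normr0 mulr_ge0.
  have [_ uD] := lip_step n IH.
  by apply: (@derive_bounded_lipschitz _ _ `]-oo, +oo[ _ M (fun x _ => uD i x)).
have u0 n : u n.+1 ^~ 0 = p by have [] := lip_step n (lip n).
have u0i n i : u n.+1 i 0 = p i by rewrite -[RHS](congr1 (@^~ i) (u0 n)).
have uD n i (s : R) : is_derive s 1 (u n.+1 i) (f i (u n ^~ s)).
  by have [_] := lip_step n (lip n); apply.
pose h := (2 * (L + 1))^-1; have h0 : 0 < h by rewrite invr_gt0; lra.
have Lh : L * h <= 2^-1.
  by rewrite /h invfM mulrCA ler_piMr// ler_pdivrMr; lra.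
have uC n i s : `|s| < h -> `|u n.+1 i s - u n i s| <= M * h / 2 ^+ n.
  elim: n i s => [|n IH] i s sh.
    rewrite expr0 divr1 -[u 0%N i s]/(p i) -(u0i 0%N).
    by apply: le_trans (lip _ _ _ _) _; rewrite subr0 ler_wpM2l // ltW.
  have D (z : R) : z \in `](- h), h[ ->
      is_derive z 1 (u n.+2 i \- u n.+1 i) (f i (u n.+1 ^~ z) - f i (u n ^~ z)).
    by have := uD n.+1 i z; have := uD n i z => ? ? _; exact: is_deriveB.
  have Db z : z \in `](- h), h[ ->
      `|f i (u n.+1 ^~ z) - f i (u n ^~ z)| <= L * (M * h / 2 ^+ n).
    by rewrite in_itv /= -ltr_norml => zh; apply: fL => j; exact: IH.
  have sI : s \in `](- h), h[ by rewrite in_itv /= -ltr_norml.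
  have zI : 0 \in `](- h), h[ by rewrite in_itv /= -ltr_norml normr0.
  have := derive_bounded_lipschitz D Db sI zI; rewrite subr0.
  rewrite -[(_ \- _) s]/(u n.+2 i s - u n.+1 i s).
  rewrite -[(_ \- _) 0]/(u n.+2 i 0 - u n.+1 i 0).
  rewrite (u0i n.+1) u0i subrr subr0 => /le_trans; apply.
  rewrite exprS invfM [X in _ <= X]mulrCA mulrAC; apply: ler_wpM2r.
    by rewrite divr_ge0 ?exprn_ge0 // mulr_ge0 // ltW.
  by apply: le_trans Lh; rewrite ler_wpM2l // ltW.
have /choice[U HU] (k : I * R) : exists l, `|k.2| < h ->
    forall n, `|u n k.1 k.2 - l| <= 2 * (M * h) / 2 ^+ n.
  have [sh|] := ltP `|k.2| h; last by exists 0.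
  have [|l Hl] := @geometric_cauchy_limit _ (fun n => u n k.1 k.2) (M * h).
    by move=> n; exact: uC.
  by exists l.
have Ulim i s n : `|s| < h -> `|u n i s - U (i, s)| <= 2 * (M * h) / 2 ^+ n.
  by move=> sh; exact: (HU (i, s)).
exists h => //; exists (fun i s => U (i, s)); split=> [i|i s sh].
  apply/eqP; rewrite -subr_eq0 -normr_le0.
  apply: (@le_geometric_limit _ _ _ (2 * (M * h))) => n.
  rewrite add0r distrC; have := Ulim i 0 n; rewrite normr0 => /(_ h0).
  have -> // : u n i 0 = p i.
  by case: n => // n; exact: u0i.
apply: (@derive_quadratic_remainder _ _ _ _ (L * M) (h - `|s|)).
  by rewrite subr_gt0.
move=> z zs; have zh : `|z| < h.
  by rewrite -(subrK s z); apply: le_lt_trans (ler_normD _ _) _; rewrite -ltrBrDr.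
set l := f i _.
apply: (@le_geometric_limit _ _ _
  (L * (2 * (M * h)) * `|z - s| + 2 * (M * h))) => n.
have D (r : R) : r \in `[Num.min s z, Num.max s z] ->
    is_derive r 1 (u n.+1 i \- l *: (@id R)) (f i (u n ^~ r) - l).
  move=> _; have := uD n i r => ?.
  have ? : is_derive r 1 (l *: (@id R)) l.
    by apply: is_derive_eq; rewrite [_ *: _]mulr1.
  exact: is_deriveB.
(* The value of the field along the iterate at [r] is compared with its limit
   value at [s] through the iterate at [s]. *)
have Db r : r \in `[Num.min s z, Num.max s z] ->
    `|f i (u n ^~ r) - l| <= L * (M * `|z - s| + 2 * (M * h) / 2 ^+ n).
  move=> rzs; apply: fL => j.
  rewrite -(subrK (u n j s) (u n j r)) -addrA.
  apply: le_trans (ler_normD _ _) _; apply: lerD; last exact: Ulim.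
  apply: le_trans (lip _ _ _ _) _; apply: ler_wpM2l => //.
  move: rzs; rewrite in_itv /=.
  case: (leP s z) => sz /andP[? ?].
    by rewrite !ger0_norm ?subr_ge0 // lerD2r.
  by rewrite !ler0_norm ?subr_le0 // ?lerN2 ?lerD2r // ltW.
have zI : z \in `[Num.min s z, Num.max s z].
  by rewrite in_itv /= ge_min le_max !lexx !orbT.
have sI : s \in `[Num.min s z, Num.max s z].
  by rewrite in_itv /= ge_min le_max !lexx.
have := derive_bounded_lipschitz D Db zI sI.
rewrite -[(_ \- _) z]/(u n.+1 i z - l * z) -[(_ \- _) s]/(u n.+1 i s - l * s).
have := Ulim i s n.+1 sh; have := Ulim i z n.+1 zh.
have -> : 2 * (M * h) / 2 ^+ n.+1 = 2 * (M * h) / 2 ^+ n / 2.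
  by rewrite exprSr invfM; ring.
have e0 : 0 <= 2 * (M * h) / 2 ^+ n.
  by rewrite divr_ge0 ?exprn_ge0 // mulr_ge0 // mulr_ge0 // ltW.
rewrite (mulrDl _ _ (2 ^+ n)^-1) (mulrAC _ `|z - s|) -[L * _ / _]mulrA.
move: (2 * (M * h) / 2 ^+ n) e0 => e e0 Uz Us.
move: (u n.+1 i z) (u n.+1 i s) (U (i, z)) (U (i, s)) Uz Us => a b c d ac bd.
move=> abl; rewrite -(subrK (a - l * z - (b - l * s)) (c - d - _)).
have -> : c - d - (z - s) * l - (a - l * z - (b - l * s)) = (b - d) - (a - c).
  by ring.
apply: le_trans (ler_normD _ _) _; have := ler_normB (b - d) (a - c).
have : L * (M * `|z - s| + e) * `|z - s| =
   L * M * `|z - s| ^+ 2 + L * e * `|z - s| by ring.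
by lra.
Qed.

Definition box (R : realType) (I : Type) (p : I -> R) (r : R) : set (I -> R) :=
  [set q | forall j, `|q j - p j| <= r].

(** Boundedness is part of the predicate because it makes the predicate stable
    under products. *)
Definition box_lipschitz (R : realType) (I : Type) (p : I -> R) (r : R)
    (g : (I -> R) -> R) : Prop :=
  exists M L, [/\ 0 <= M, 0 <= L, forall q, box p r q -> `|g q| <= M &
    forall q q' e, box p r q -> box p r q' -> 0 <= e ->
      (forall j, `|q j - q' j| <= e) -> `|g q - g q'| <= L * e].

Section BoxLipschitz.
Context (R : realType) (I : Type) (p : I -> R) (r : R).
Implicit Types g : (I -> R) -> R.

Lemma box_lipschitz_cst (c : R) : box_lipschitz p r (fun=> c).
Proof.
by exists `|c|, 0; split=> // *; rewrite subrr normr0 mul0r.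
Qed.

Lemma box_lipschitz_coord (i : I) : box_lipschitz p r (fun q => q i).
Proof.
exists (`|r| + `|p i|), 1; split=> [||q qp|q q' e _ _ _ qq'].
- by rewrite addr_ge0.
- by [].
- rewrite -(subrK (p i) (q i)); apply: le_trans (ler_normD _ _) _.
  by rewrite lerD2r; apply: le_trans (qp i) (ler_norm r).
- by rewrite mul1r.
Qed.

Lemma box_lipschitzD g g' : box_lipschitz p r g -> box_lipschitz p r g' ->
  box_lipschitz p r (fun q => g q + g' q).
Proof.
move=> [M [L [M0 L0 gM gL]]] [M' [L' [M'0 L'0 g'M g'L]]].
exists (M + M'), (L + L'); split=> [||q qp|q q' e qp q'p e0 qq'].
- exact: addr_ge0.
- exact: addr_ge0.
- by apply: le_trans (ler_normD _ _) _; rewrite lerD ?gM ?g'M.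
- rewrite opprD addrACA mulrDl; apply: le_trans (ler_normD _ _) _.
  by rewrite lerD ?gL ?g'L.
Qed.

Lemma box_lipschitzM g g' : box_lipschitz p r g -> box_lipschitz p r g' ->
  box_lipschitz p r (fun q => g q * g' q).
Proof.
move=> [M [L [M0 L0 gM gL]]] [M' [L' [M'0 L'0 g'M g'L]]].
exists (M * M'), (M * L' + L * M'); split=> [||q qp|q q' e qp q'p e0 qq'].
- exact: mulr_ge0.
- by rewrite addr_ge0 // mulr_ge0.
- by rewrite normrM ler_pM ?gM ?g'M.
- have -> : g q * g' q - g q' * g' q' =
    g q * (g' q - g' q') + (g q - g q') * g' q' by ring.
  apply: le_trans (ler_normD _ _) _; rewrite !normrM mulrDl -mulrA.
  by rewrite (mulrAC L) lerD // ler_pM ?gM ?g'M ?gL ?g'L.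
Qed.

Lemma box_lipschitzX g n : box_lipschitz p r g ->
  box_lipschitz p r (fun q => g q ^+ n).
Proof.
move=> gl; elim: n => [|n IH]; first exact: box_lipschitz_cst.
by under eq_fun do rewrite exprS; exact: box_lipschitzM.
Qed.

Lemma box_lipschitz_horner g (P : {poly R}) : box_lipschitz p r g ->
  box_lipschitz p r (fun q => P.[g q]).
Proof.
move=> gl; elim/poly_ind: P => [|P c IH].
  by under eq_fun do rewrite horner0; exact: box_lipschitz_cst.
under eq_fun do rewrite hornerMXaddC.
by apply: box_lipschitzD (box_lipschitz_cst c); exact: box_lipschitzM.
Qed.

Lemma box_lipschitz_sum (J : Type) (s : seq J) (g : J -> (I -> R) -> R) :
  (forall j, box_lipschitz p r (g j)) ->
  box_lipschitz p r (fun q => \sum_(j <- s) g j q).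
Proof.
move=> gl; elim: s => [|j s IH].
  by under eq_fun do rewrite big_nil; exact: box_lipschitz_cst.
by under eq_fun do rewrite big_cons; exact: box_lipschitzD.
Qed.

End BoxLipschitz.

Lemma clamp_contraction (R : realType) (lo hi a b : R) : lo <= hi ->
  `|Num.max lo (Num.min hi a) - Num.max lo (Num.min hi b)| <= `|a - b|.
Proof.
wlog ab : a b / a <= b => [H lh|lh].
  have [/H|/ltW /H] := leP a b; first exact.
  by rewrite distrC (distrC a); apply.
rewrite (distrC a) (ger0_norm (_ : 0 <= b - a)) ?subr_ge0 // ler_norml.
rewrite !maxEle !minEle.
by case: (leP hi a) => ?; case: (leP hi b) => ?; case: (leP lo hi) => ?;
  case: (leP lo a) => ?; case: (leP lo b) => ?; apply/andP; split; lra.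
Qed.

(** Composing the field with the projection onto the box makes it globally bounded
    and Lipschitz; since the velocity is bounded, the solution of the modified
    equation stays for a short time in the box, where the two fields agree. *)
Lemma picard_lindelof_local (R : realType) (I : finType)
    (f : I -> (I -> R) -> R) (p : I -> R) (r : R) : 0 < r ->
  (forall i, box_lipschitz p r (f i)) ->
  exists2 h : R, 0 < h & exists u : I -> R -> R, (forall i, u i 0 = p i) /\
    forall i (s : R), `|s| < h -> is_derive s 1 (u i) (f i (u ^~ s)).
Proof.
move=> r0 /choice[M /choice[L fML]].
have M0 i : 0 <= M i by have [] := fML i.
have L0 i : 0 <= L i by have [] := fML i.
pose c (q : I -> R) j := Num.max (p j - r) (Num.min (p j + r) (q j)).
have pr j : p j - r <= p j + r by lra.
have cbox q : box p r (c q).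
  move=> j; rewrite ler_norml /c maxEle minEle.
  by case: (leP (p j + r)) => ?; case: (leP (p j - r)) => ?;
    apply/andP; split; lra.
have cid q : box p r q -> c q = q.
  move=> qb; apply/funext => j; rewrite /c; have := qb j.
  by rewrite ler_norml => /andP[? ?]; rewrite min_r ?max_r; lra.
(* Sums over the coordinates serve as common bounds for all of them. *)
pose S (K : I -> R) := \sum_i K i.
have leS (K : I -> R) i : (forall j, 0 <= K j) -> K i <= S K.
  by move=> K0; rewrite /S (bigD1 i) //= lerDl sumr_ge0.
have [||i q|q q' e qq' i|h h0 [u [u0 uD]]] :=
    @picard_lindelof R I (fun i q => f i (c q)) p (S M) (S L).
- exact: sumr_ge0.
- exact: sumr_ge0.
- by have [_ _ fM _] := fML i; apply: le_trans (fM _ (cbox q)) _; exact: leS.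
- have e0 : 0 <= e by apply: le_trans (qq' i).
  have [_ _ _ fL] := fML i; apply: (@le_trans _ _ (L i * e)).
    apply: fL => // j; apply: le_trans (qq' j).
    exact: clamp_contraction.
  by apply: ler_wpM2r => //; exact: leS.
have S1 : 0 < S M + 1 by rewrite ltr_wpDl // sumr_ge0.
have rS : 0 < r / (S M + 1) by rewrite divr_gt0.
exists (Num.min h (r / (S M + 1))); first by rewrite lt_min h0 rS.
exists u; split=> // i s; rewrite lt_min => /andP[sh sr].
suff ub : box p r (u ^~ s) by have := uD i s sh; rewrite cid.
move=> j; rewrite -(u0 j).
have D (x : R) : x \in `](- h), h[ -> is_derive x 1 (u j) (f j (c (u ^~ x))).
  by rewrite in_itv /= -ltr_norml; exact: uD.
have Db x : x \in `](- h), h[ -> `|f j (c (u ^~ x))| <= S M.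
  move=> _; have [_ _ fM _] := fML j.
  by apply: le_trans (fM _ (cbox _)) _; exact: leS.
have sI : s \in `](- h), h[ by rewrite in_itv /= -ltr_norml.
have zI : 0 \in `](- h), h[ by rewrite in_itv /= -ltr_norml normr0.
have := derive_bounded_lipschitz D Db sI zI; rewrite subr0 => /le_trans; apply.
move: sr; rewrite ltr_pdivlMr // mulrDr mulr1 mulrC.
by have := normr_ge0 s; lra.
Qed.

(** * Maximal solutions *)

(** A solution is encoded as the triple of its interval and its coordinates. *)
Definition extends (R : realType) (k l : set R * (R -> R) * (R -> R)) : Prop :=
  k.1.1 `<=` l.1.1 /\ forall t, k.1.1 t -> l.1.2 t = k.1.2 t /\ l.2 t = k.2 t.

(** Any finitely many points of the union of the domains lie in a single member of
    the chain, so that being an interval and solving the equation pass to the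
    union. *)
Lemma chain_union_solution (R : realType) (P Q : {poly {poly R}})
    (C : set (set R * (R -> R) * (R -> R))) : C !=set0 ->
  (forall k l, C k -> C l -> extends k l \/ extends l k) ->
  (forall k, C k -> solution P Q k.1.1 k.1.2 k.2) ->
  exists l, solution P Q l.1.1 l.1.2 l.2 /\ forall k, C k -> extends k l.
Proof.
move=> [k0 Ck0] Ctot Csol.
pose J := \bigcup_(k in C) k.1.1.
have /choice[K KE] t : exists k, J t -> C k /\ k.1.1 t.
  have [[k Ck kt]|nJ] := pselect (J t); last by exists k0.
  by exists k.
pose u t := (K t).1.2 t; pose v t := (K t).2 t.
have uvE k t : C k -> k.1.1 t -> u t = k.1.2 t /\ v t = k.2 t.
  move=> Ck kt; have [|CK Kt] := KE t; first by exists k.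
  have [[_ /(_ t kt)]|[_ /(_ t Kt)]] := Ctot k (K t) Ck CK; first by [].
  by move=> [-> ->].
exists (J, u, v); split=> [/=|k Ck]; last first.
  by split=> [t kt|t /(uvE k t Ck) //]; exists k.
split=> [|||t [k Ck kt]].
- by have [[t tI] _ _ _] := Csol k0 Ck0; exists t, k0.
- by apply: bigcup_open => k Ck; have [] := Csol k Ck.
- move=> a b [k Ck ka] [l Cl lb] c acb.
  have [[kl _]|[lk _]] := Ctot k l Ck Cl.
    by have [_ _ itv _] := Csol l Cl; exists l => //;
      apply: itv acb => //; apply: kl.
  by have [_ _ itv _] := Csol k Ck; exists k => //;
    apply: itv acb => //; apply: lk.
have [_ op _ /(_ t kt)[Dx Dy]] := Csol k Ck.
have [-> ->] := uvE k t Ck kt.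
have kn : \forall z \near t, k.1.1 z by exact: open_nbhs_nbhs.
split.
  by apply: near_eq_is_derive Dx => //; apply: filterS kn => z /(uvE k z Ck)[].
by apply: near_eq_is_derive Dy => //; apply: filterS kn => z /(uvE k z Ck)[].
Qed.

(** Zorn's lemma for the preorder [extends]. It is only a preorder because the
    coordinates of a solution have arbitrary values outside its interval. *)
Lemma maximal_extension (R : realType) (P Q : {poly {poly R}}) (I : set R)
    (x y : R -> R) : solution P Q I x y ->
  exists J u v, maximal_solution P Q J u v /\ extends (I, x, y) (J, u, v).
Proof.
move=> sol.
have ext_refl k : @extends R k k by split.
have ext_trans k l n : @extends R k l -> extends l n -> extends k n.
  move=> [kl klE] [ln lnE]; split=> [t /kl /ln //|t kt].
  by have [-> ->] := lnE t (kl t kt); exact: klE.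
pose T := {k : set R * (R -> R) * (R -> R) |
  solution P Q k.1.1 k.1.2 k.2 /\ extends (I, x, y) k}.
pose t0 : T := exist _ (I, x, y) (conj sol (ext_refl _)).
pose rT (s t : T) := `[< extends (sval s) (sval t) >].
have [||A Atot|[[[J u] v] [Jsol IJ]] Jmax] := @ZL_preorder T t0 rT.
- by move=> t; apply/asboolP.
- by move=> r s t /asboolP rs /asboolP st; apply/asboolP; exact: ext_trans st.
- have [[a Aa]|A0] := pselect (A !=set0); last first.
    by exists t0 => s As; exfalso; apply: A0; exists s.
  have [|k l [s As <-] [t At <-]|k [[k' [ksol kext]] Ak <-]|l [lsol lext]] :=
      @chain_union_solution R P Q (sval @` A).
  + by exists (sval a), a.
  + by have [/asboolP|/asboolP] := Atot s t As At; [left|right].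
  + exact: ksol.
  + have Il : extends (I, x, y) l.
      by apply: ext_trans (proj2 (svalP a)) (lext _ _); exists a.
    exists (exist _ l (conj lsol Il)) => s As; apply/asboolP; apply: lext.
    by exists s.
exists J, u, v; split=> //; split=> // J' u' v' sol' JJ' uvE.
have J'ext : extends (J, u, v) (J', u', v') by split.
have := Jmax (exist _ (J', u', v') (conj sol' (ext_trans _ _ _ IJ J'ext))).
by move=> /(_ (asboolT J'ext)) /asboolP[].
Qed.

(** * Inversion of time and limits on the Poincare sphere *)

Lemma increasing_inverse (R : realType) (T dT : R -> R) (b : R) : 0 < b ->
  (forall s : R, 0 <= s <= b -> is_derive s 1 T (dT s)) ->
  (forall s, 0 < s < b -> 0 < dT s) ->
  (forall s s', 0 <= s -> s' <= b -> s < s' -> T s < T s') /\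
  exists sg : R -> R, forall t : R, T 0 < t < T b ->
    [/\ 0 < sg t < b, T (sg t) = t & is_derive t 1 sg (dT (sg t))^-1].
Proof.
move=> b0 TD dT0.
have Tcont : {within `[0, b], continuous T}.
  apply: derivable_within_continuous => z; rewrite in_itv /= => /TD.
  by move=> [].
have Tlt s s' : 0 <= s -> s' <= b -> s < s' -> T s < T s'.
  move=> s0 s'b ss'; rewrite -subr_gt0.
  have [x||c] := @MVT R T dT s s' ss'.
  - rewrite in_itv /= => /andP[sx xs']; apply: TD.
    by rewrite (le_trans s0 (ltW sx)) (le_trans (ltW xs') s'b).
  - apply: derivable_within_continuous => z; rewrite in_itv /= => /andP[sz zs'].
    have [|] := TD z; last by [].
    by rewrite (le_trans s0 sz) (le_trans zs' s'b).
  - rewrite in_itv /= => /andP[sc cs'] ->; apply: mulr_gt0.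
      by apply: dT0; rewrite (le_lt_trans s0 sc) (lt_le_trans cs' s'b).
    by rewrite subr_gt0.
split=> //.
have /choice[sg sgE] t : exists s, T 0 < t < T b -> 0 < s < b /\ T s = t.
  have [/andP[t0 tb]|] := boolP (T 0 < t < T b); last by exists 0.
  have [|s] := @IVT R T 0 b t (ltW b0) Tcont.
    have Tb := lt_trans t0 tb.
    by rewrite ge_min (ltW t0) le_max (ltW tb) orbT.
  rewrite in_itv /= => /andP[s0 sb] Ts; exists s => _; split=> //.
  rewrite !lt_neqAle s0 sb !andbT; apply/andP; split.
    by apply: contraTneq t0 => ->; rewrite -Ts ltxx.
  by apply: contraTneq tb => <-; rewrite -Ts ltxx.
exists sg => t tT; have [/andP[s0 sb] Ts] := sgE t tT; split=> //.
  by rewrite s0.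
rewrite -[X in is_derive X]Ts; apply: (@is_derive_inverse _ T).
- near=> z.
  have z0 : 0 < z by near: z; exact: lt_nbhsr.
  have zb : z < b by near: z; exact: lt_nbhsl.
  have [|/andP[z'0 z'b] Tz] := sgE (T z).
    by rewrite !Tlt // ltW.
  have [|zz'|//] := ltgtP (sg (T z)) z.
    by move=> /(Tlt _ _ (ltW z'0) (ltW zb)); rewrite Tz ltxx.
  by have := Tlt _ _ (ltW z0) (ltW z'b) zz'; rewrite Tz ltxx.
- near=> z.
  have z0 : 0 < z by near: z; exact: lt_nbhsr.
  have zb : z < b by near: z; exact: lt_nbhsl.
  have [|dz _] := TD z; first by rewrite !ltW.
  exact/differentiable_continuous/derivable1_diffP.
- by apply: TD; rewrite !ltW.
- by rewrite gt_eqF // dT0 // s0.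
Unshelve. all: by end_near. Qed.

(** Multiplying numerators and denominators by [w] removes the singularity at
    [w = 0]. *)
Lemma poincare_proj_inv (R : realType) (x w : R) : 0 < w ->
  let E := Num.sqrt (w ^+ 2 + (x * w) ^+ 2 + 1) in
  poincare_proj x w^-1 = (x * w / E, E^-1, w / E).
Proof.
move=> w0 E; have w1 : w != 0 by rewrite gt_eqF.
have -> : poincare_proj x w^-1 = (x / (E / w), w^-1 / (E / w), 1 / (E / w)).
  rewrite /poincare_proj; suff -> : Num.sqrt (1 + x ^+ 2 + w^-1 ^+ 2) = E / w by [].
  have -> : 1 + x ^+ 2 + w^-1 ^+ 2 = (w ^+ 2 + (x * w) ^+ 2 + 1) / w ^+ 2.
    by field.
  rewrite sqrtrM; last by rewrite !addr_ge0 ?sqr_ge0.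
  by rewrite sqrtrV ?sqr_ge0 // sqrtr_sqr gtr0_norm.
have E0 : E != 0.
  by rewrite gt_eqF // sqrtr_gt0 ltr_wpDl // addr_ge0 // sqr_ge0.
by congr (_, _, _); field; rewrite w1 E0.
Qed.

Lemma poincare_proj_cvg (R : realType) (T : Type) (F : set_system T)
    {FF : Filter F} (x w : T -> R) (a : R) :
  x @ F --> a -> w @ F --> (0 : R) -> (\forall s \near F, 0 < w s) ->
  (fun s => poincare_proj (x s) (w s)^-1) @ F --> (0 : R, 1 : R, 0 : R).
Proof.
move=> xa w0 wpos.
have xw0 : (fun s => x s * w s) @ F --> (0 : R).
  by rewrite -(mulr0 a); exact: cvgM.
pose E s := Num.sqrt (w s ^+ 2 + (x s * w s) ^+ 2 + 1).
have E1 : (fun s => (E s)^-1) @ F --> (1 : R).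
  rewrite -[X in _ --> X]invr1; apply: cvgV; first exact: oner_neq0.
  rewrite -[X in _ --> X]sqrtr1; apply: continuous_cvg; first exact: sqrt_continuous.
  rewrite -[X in _ --> X]add0r -[X in X + 1]addr0; apply: cvgD; last exact: cvg_cst.
  apply: cvgD; rewrite -[X in _ --> X](mulr0 0); exact: cvgM.
have : (fun s => (x s * w s / E s, (E s)^-1, w s / E s)) @ F
    --> (0 : R, 1 : R, 0 : R).
  have xE0 : (fun s => x s * w s / E s) @ F --> (0 : R).
    by rewrite -[X in _ --> X](mul0r 1); exact: cvgM.
  have wE0 : (fun s => w s / E s) @ F --> (0 : R).
    by rewrite -[X in _ --> X](mul0r 1); exact: cvgM.
  by have := cvg_pair (cvg_pair xE0 E1) wE0; apply.
apply: cvg_trans; apply: near_eq_cvg.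
by apply: filterS wpos => s ws; rewrite poincare_proj_inv.
Qed.

(** * Newton systems near the end of the y-axis *)

Lemma poly_neq0_nonroot (R : realType) (p : {poly R}) :
  p != 0 -> exists a, p.[a] != 0.
Proof.
move=> p0; apply: contrapT => nroot.
have := max_poly_roots p0 (rs := [seq i%:R | i <- iota 0 (size p)]).
rewrite size_map size_iota ltnn map_inj_uniq ?iota_uniq; last first.
  by move=> i j /eqP; rewrite eqr_nat => /eqP.
suff -> : all (root p) [seq i%:R | i <- iota 0 (size p)] by move=> /(_ isT isT).
by apply/allP => a _; apply/negPn/negP => pa; apply: nroot; exists a.
Qed.

Section Newton.
Context (R : realType) (m : nat) (P : 'I_m.+1 -> {poly R}).

Definition newton_rhs : {poly {poly R}} := \sum_(i < m.+1) P i *: 'X^i.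

(** With [w = 1 / y], this is [w ^+ m] times the right-hand side of the equation
    for [y]; it is regular at [w = 0], that is, at [y] infinite. *)
Definition newton_chart (x w : R) : R :=
  \sum_(i < m.+1) (P i).[x] * w ^+ (m - i).

Lemma eval2X (x y : R) : eval2 'X x y = y.
Proof. by rewrite /eval2 hornerX hornerC. Qed.

Lemma eval2_newton_rhs (x y : R) :
  eval2 newton_rhs x y = \sum_(i < m.+1) (P i).[x] * y ^+ i.
Proof.
rewrite /eval2 horner_sum horner_sum; apply: eq_bigr => i _.
by rewrite hornerZ hornerXn hornerM -polyC_exp hornerC.
Qed.

Lemma newton_chartE (x w : R) : w != 0 ->
  newton_chart x w / w ^+ m = eval2 newton_rhs x w^-1.
Proof.
move=> w0; rewrite eval2_newton_rhs mulr_suml; apply: eq_bigr => i _.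
rewrite -mulrA exprVn; congr (_ * _).
have im : (i <= m)%N by rewrite -ltnS.
move: (nat_of_ord i) im => k km; rewrite -{2}(subnK km) exprD invfM mulrA divff ?mul1r //.
by rewrite expf_neq0.
Qed.

Lemma newton_chart0 (x : R) : newton_chart x 0 = (P ord_max).[x].
Proof.
rewrite /newton_chart (bigD1 ord_max) //= subnn expr0 mulr1 big1 ?addr0 // => i im.
rewrite expr0n subn_eq0; case: leqP => [mi|_]; last by rewrite mulr0.
case/negP: im; apply/eqP/val_inj/eqP => /=.
by rewrite eqn_leq mi -ltnS ltn_ord.
Qed.

Lemma total_degree_newton_rhs : P ord_max != 0 ->
  (m <= total_degree newton_rhs)%N.
Proof.
move=> Pm0.
have co : newton_rhs`_m = P ord_max.
  rewrite /newton_rhs coef_sum (bigD1 ord_max) //= coefZ coefXn eqxx mulr1.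
  rewrite big1 ?addr0 // => i im; rewrite coefZ coefXn.
  case: eqP => [mi|_]; last by rewrite mulr0.
  by case/negP: im; apply/eqP/val_inj.
have ms : (m < size newton_rhs)%N.
  by rewrite ltnNge; apply/negP => /leq_sizeP/(_ m (leqnn m)); rewrite co; exact/eqP.
rewrite /total_degree.
have := @leq_bigmax_cond _ (fun j : 'I_(size newton_rhs) => newton_rhs`_j != 0)
  (fun j : 'I_(size newton_rhs) => (j + (size (newton_rhs`_j)%R).-1)%N)
  (Ordinal ms).
by rewrite /= co => /(_ Pm0); apply: leq_trans; exact: leq_addr.
Qed.

(** At [(0, 1, 0)] only the first component of the field can be nonzero; there it
    is the homogenization of [y], which contains a positive power of [z3] as soon
    as the degree of the system is at least [2]. *)
Lemma newton_equilibrium : (2 <= m)%N -> P ord_max != 0 ->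
  equilibrium_at_infinity 'X newton_rhs (0, 1, 0).
Proof.
move=> m2 Pm0; split; first by split=> //=; rewrite expr0n expr1n add0r.
have d2 : (2 <= system_degree 'X newton_rhs)%N.
  by rewrite leq_max (leq_trans m2 (total_degree_newton_rhs Pm0)) orbT.
rewrite /poincare_field /=.
have -> : @homogenize R (system_degree 'X newton_rhs) 'X 0 1 0 = 0.
  rewrite /homogenize; apply: big1 => j _; apply: big1 => -[i /= _] _.
  rewrite coefX; have [j1|] := eqVneq (j : nat) 1%N; last by rewrite coef0 !mul0r.
  rewrite coefC; have [->|] := eqVneq i 0%N; last by rewrite !mul0r.
  by rewrite j1 [0 ^+ (_ - _)]expr0n subn_eq0 leqNgt d2 mulr0.
by rewrite !(mulr0, mul0r, expr1n, subrr, oppr0).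
Qed.

(** In the coordinates [x] and [w = 1 / y] the system reads [x' = 1 / w] and
    [w' = - newton_chart x w / w ^+ (m - 2)]. Multiplying it by
    [- e * w ^+ (m - 2)] gives a polynomial field, and here [3 <= m] is essential:
    otherwise [x' = - e * w ^ (m - 3)] would be singular at [w = 0]. The third
    coordinate [T] records the original time, up to the factor [- e]. *)
Lemma newton_chart_flow (a e : R) : (3 <= m)%N ->
  exists2 h : R, 0 < h & exists X W T : R -> R,
  [/\ X 0 = a, W 0 = 0, T 0 = 0 & forall s : R, `|s| < h ->
    [/\ is_derive s 1 X (- e * W s ^+ (m - 3)),
        is_derive s 1 W (e * newton_chart (X s) (W s)) &
        is_derive s 1 T (W s ^+ (m - 2))]].
Proof.
move=> m3.
pose x : 'I_3 := 0; pose w : 'I_3 := 1; pose t : 'I_3 := 2%:R.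
pose f (i : 'I_3) (q : 'I_3 -> R) : R :=
  nth 0 [:: - e * q w ^+ (m - 3); e * newton_chart (q x) (q w);
            q w ^+ (m - 2)] i.
pose p (i : 'I_3) : R := if i == x then a else 0.
have fl i : box_lipschitz p 1 (f i).
  case: i => [[|[|[|//]]] i3]; rewrite /f /=.
  - apply: box_lipschitzM; first exact: box_lipschitz_cst.
    exact/box_lipschitzX/box_lipschitz_coord.
  - apply: box_lipschitzM; first exact: box_lipschitz_cst.
    apply: box_lipschitz_sum => i; apply: box_lipschitzM.
      exact/box_lipschitz_horner/box_lipschitz_coord.
    exact/box_lipschitzX/box_lipschitz_coord.
  - exact/box_lipschitzX/box_lipschitz_coord.
have [h h0 [u [u0 uD]]] := picard_lindelof_local ltr01 fl.
exists h => //; exists (u x), (u w), (u t); split; [exact: u0..|].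
by move=> s sh; split; [exact: (uD x)|exact: (uD w)|exact: (uD t)].
Qed.

End Newton.

(** * The orbit that blows up *)

Lemma derive_gt0_at_right (R : realType) (W : R -> R) (c : R) :
  is_derive (0 : R) 1 W c -> W 0 = 0 -> 0 < c -> \forall s \near 0^'+, 0 < W s.
Proof.
move=> /is_derive1_caratheodory[g [WE gc g0]] W0 c0.
have gpos : \forall s \near (0 : R), 0 < g s.
  have gc' : g @ (0 : R) --> g 0 by exact: gc.
  by apply: (cvgr_gt (g 0) gc'); rewrite g0.
near=> s; have := WE s; rewrite W0 !subr0 => ->; apply: mulr_gt0.
  by near: s; apply: cvg_within; exact: gpos.
by near: s; exact: nbhs_right_gt.
Unshelve. all: by end_near. Qed.

Lemma is_derive_continuous (R : realType) (f : R -> R) (x l : R) :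
  is_derive x 1 f l -> {for x, continuous f}.
Proof. by move=> [d _]; exact/differentiable_continuous/derivable1_diffP. Qed.

(** Following the flow of the regularized field in the original time [t], with
    [- e * t = T s], gives a solution of the Newton system. *)
Lemma time_change_solution (R : realType) (m : nat) (P : 'I_m.+1 -> {poly R})
    (e b : R) (X W T sg : R -> R) :
  (3 <= m)%N -> e = 1 \/ e = -1 -> 0 < T b ->
  (forall s : R, 0 < s < b -> [/\ 0 < W s,
     is_derive s 1 X (- e * W s ^+ (m - 3)) &
     is_derive s 1 W (e * newton_chart P (X s) (W s))]) ->
  (forall t : R, 0 < t < T b ->
     [/\ 0 < sg t < b, T (sg t) = t &
        is_derive t 1 sg (W (sg t) ^+ (m - 2))^-1]) ->
  solution 'X (newton_rhs P) [set t | 0 < - e * t < T b]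
    (fun t => X (sg (- e * t))) (fun t => (W (sg (- e * t)))^-1).
Proof.
move=> m3 e1 Tb flow sgP; set I := [set t | _].
have ee : e * e = 1 by case: e1 => ->; rewrite ?mulrNN mulr1.
split.
- exists (- e * (T b / 2)); rewrite /I /= mulrA mulrNN ee mul1r.
  by apply/andP; split; lra.
- have -> : I = ( *%R (- e)) @^-1` [set` `]0, (T b)[].
    by apply/seteqP; split => t; rewrite /I /= in_itv.
  apply: open_comp; last exact: itv_open.
  by move=> t _; exact: mulrl_continuous.
- move=> s t; rewrite /I /= => /andP[s0 sT] /andP[t0 tT] r /andP[sr rt].
  by case: e1 s0 sT t0 tT => -> *; apply/andP; split; lra.
move=> t tI; have [sb Ts sD] := sgP _ tI.
have [W0 XD WD] := flow _ sb.
have w0 : W (sg (- e * t)) != 0 by rewrite gt_eqF.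
have eD : is_derive t 1 ( *%R (- e)) (- e).
  have : is_derive t 1 ((- e) *: (@id R)) (- e *: 1) by apply: is_derive_eq.
  by rewrite [_ *: 1]mulr1.
have sgD : is_derive t 1 (fun t => sg (- e * t))
    ((W (sg (- e * t)) ^+ (m - 2))^-1 * - e).
  exact: (@is_derive1_comp _ sg ( *%R (- e))).
have m23 : (m - 2 = (m - 3).+1)%N by rewrite -subSn.
split.
  rewrite eval2X.
  have -> : (W (sg (- e * t)))^-1 = - e * W (sg (- e * t)) ^+ (m - 3) *
      ((W (sg (- e * t)) ^+ (m - 2))^-1 * - e).
    rewrite m23 exprS invfM; move: (W _) w0 => w w0.
    transitivity (e * e * (w ^+ (m - 3) / w ^+ (m - 3)) / w); last by ring.
    by rewrite ee divff ?expf_neq0 // !mul1r.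
  exact: (@is_derive1_comp _ X (fun t => sg (- e * t))).
rewrite -newton_chartE //.
have WsD : is_derive t 1 (fun t => W (sg (- e * t)))
    (e * newton_chart P (X (sg (- e * t))) (W (sg (- e * t))) *
      ((W (sg (- e * t)) ^+ (m - 2))^-1 * - e)).
  exact: (@is_derive1_comp _ W (fun t => sg (- e * t))).
pose w (t : R) := W (sg (- e * t)).
suff <- : - w t ^- 2 * (e * newton_chart P (X (sg (- e * t))) (w t) *
   (w t ^- (m - 2) * - e)) = newton_chart P (X (sg (- e * t))) (w t) / w t ^+ m.
  exact: (@is_deriveV _ w).
move: (newton_chart _ _ _) => G.
have -> : w t ^- m = w t ^- 2 * w t ^- (m - 2).
  by rewrite -invfM -exprD subnKC // ltnW.
move: (w t ^- 2) (w t ^- (m - 2)) => y z.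
by transitivity (e * e * G * y * z); [ring|rewrite ee; ring].
Qed.

(** The trajectory of the regularized field through [x = a], [w = 0] crosses the
    line [w = 0] transversally when [a] is not a root of the leading coefficient.
    Its half with [w > 0] is, in the original time, an orbit on which [y] is
    infinite at time [0] while [x] tends to [a]. The sign [e] of the leading
    coefficient at [a] says whether time [0] is reached forward ([e = 1]) or
    backward ([e = -1]), and ordering the times by [e * t] treats both cases at
    once. A maximal extension is still defined on one side of [0] only, so that it
    has the same end. *)
Lemma newton_vertical_blowup (R : realType) (m : nat)
    (P : 'I_m.+1 -> {poly R}) :
  (3 <= m)%N -> P ord_max != 0 ->
  exists e : R, (e = 1 \/ e = -1) /\
  exists J u v, maximal_solution 'X (newton_rhs P) J u v /\
  forall B, nbhs (0 : R, 1 : R, 0 : R) B ->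
    exists2 s, J s & forall t, J t -> e * s < e * t ->
      B (poincare_proj (u t) (v t)).
Proof.
move=> m3 /poly_neq0_nonroot[a Pa].
have [e e1 ePa] : exists2 e : R, e = 1 \/ e = -1 & 0 < e * (P ord_max).[a].
  have [Pa0|Pa0] := ltP 0 (P ord_max).[a].
    by exists 1; [left|rewrite mul1r].
  by exists (-1); [right|rewrite mulN1r oppr_gt0 lt_neqAle Pa].
exists e; split=> //.
have [h h0 [X [W [T [X0 W0 T0 flow]]]]] := newton_chart_flow P a e m3.
have flow0 : `|0 : R| < h by rewrite normr0.
have [X'0 W'0 T'0] := flow 0 flow0.
have [d /= d0 dW] : \forall s \near 0^'+, 0 < W s.
  by apply: (derive_gt0_at_right W'0 W0); rewrite X0 W0 newton_chart0.
(* Half of the minimum, so that the flow is differentiable at [b] too. *)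
pose b := Num.min h d / 2.
have b0 : 0 < b by rewrite divr_gt0 // lt_min h0 d0.
have bhd : b < h /\ b < d.
  by rewrite /b minEle; case: (leP h d) => ?; split; lra.
have [bh bd] := bhd.
have bflow s : 0 <= s <= b -> `|s| < h.
  by move=> /andP[s0 sb]; rewrite ger0_norm // (le_lt_trans sb).
have Wpos s : 0 < s < b -> 0 < W s.
  move=> /andP[s0 sb]; apply: dW => //=.
  by rewrite sub0r normrN gtr0_norm // (lt_trans sb).
have [||Tlt [sg sgP]] := @increasing_inverse R T (fun s => W s ^+ (m - 2)) b b0.
- by move=> s /bflow /flow[].
- by move=> s sb; rewrite exprn_gt0 // Wpos.
rewrite T0 in sgP.
have Tpos s : 0 < s <= b -> 0 < T s.
  by move=> /andP[s0 sb]; rewrite -T0 Tlt.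
have Tb : 0 < T b by rewrite Tpos // b0 lexx.
have flowb s : 0 < s < b -> [/\ 0 < W s,
    is_derive s 1 X (- e * W s ^+ (m - 3)) &
    is_derive s 1 W (e * newton_chart P (X s) (W s))].
  move=> sb; have /andP[/ltW s0 /ltW sb'] := sb.
  by have [|] := flow s; [rewrite bflow // s0|split=> //; exact: Wpos].
have sol := time_change_solution m3 e1 Tb flowb sgP.
have ee : e * e = 1 by case: e1 => ->; rewrite ?mulrNN mulr1.
have [J [u [v [Jmax [/= IJ uvE]]]]] := maximal_extension sol.
have JI s : 0 < s < T b -> J (- e * s).
  by move=> sT; apply: IJ; rewrite /= mulrA mulrNN ee mul1r.
have TI s : 0 < s < b -> 0 < T s < T b.
  by move=> /andP[s0 sb]; rewrite Tpos ?s0 ?(ltW sb) //= Tlt // ltW.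
have sgT s : 0 < s < b -> sg (T s) = s.
  move=> /[dup] /TI /sgP[/andP[g0 gb] Tg _] /andP[s0 sb].
  have [gs|sgg|//] := ltgtP (sg (T s)) s.
    by have := Tlt _ _ (ltW g0) (ltW sb) gs; rewrite Tg ltxx.
  by have := Tlt _ _ (ltW s0) (ltW gb) sgg; rewrite Tg ltxx.
have right_cvg (f : R -> R) l : is_derive (0 : R) 1 f l -> f @ 0^'+ --> f 0.
  by move=> /is_derive_continuous fc; apply: cvg_within_filter; exact: fc.
have Xa : X @ 0^'+ --> a by rewrite -X0; exact: right_cvg X'0.
have W_0 : W @ 0^'+ --> (0 : R) by rewrite -[X in _ --> X]W0; exact: right_cvg W'0.
have T_0 : T @ 0^'+ --> (0 : R) by rewrite -[X in _ --> X]T0; exact: right_cvg T'0.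
have Wnear : \forall s \near 0^'+, 0 < s < b.
  by near=> s; apply/andP; split; near: s;
    [exact: nbhs_right_gt|exact: nbhs_right_lt].
(* Otherwise the interval [J] contains [0], where [v] is continuous; but [v] is
   [1 / W] along the orbit, and [W] tends to [0]. *)
have Jpos t : J t -> 0 < - e * t.
  move=> Jt; rewrite ltNge; apply/negP => et.
  have [[_ _ Jitv JD] _] := Jmax.
  have J0 : J 0.
    have := JI (T b / 2); set t' := - e * _ => /(_ _)/wrap[].
      by apply/andP; split; lra.
    have et' : 0 < - e * t' by rewrite /t' mulrA mulrNN ee mul1r divr_gt0.
    move=> Jt'; have [tt'|tt'] := leP t t'.
      apply: (Jitv t t') => //.
      by case: e1 et et' => -> *; apply/andP; split; lra.
    apply: (Jitv t' t) => //.
    by case: e1 et et' => -> *; apply/andP; split; lra.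
  have [_ /is_derive_continuous vc] := JD 0 J0.
  have eT0 : (fun s => - e * T s) @ 0^'+ --> (0 : R).
    by rewrite -[X in _ --> X](mulr0 (- e)); apply: cvgMr.
  have : (fun s => v (- e * T s) * W s) @ 0^'+ --> v 0 * 0.
    by apply: cvgM => //; apply: cvg_comp eT0 vc.
  have : (fun s => v (- e * T s) * W s) @ 0^'+ --> (1 : R).
    apply: cvg_near_cst; apply: filterS Wnear => s sb.
    have [|_ ->] := uvE (- e * T s).
      by rewrite /= mulrA mulrNN ee mul1r TI.
    by rewrite mulrA mulrNN ee mul1r sgT // mulVf // gt_eqF // Wpos.
  move=> H1 H0; have : (1 : R) = v 0 * 0.
    by exact: (cvg_unique (@Rhausdorff R) H1 H0).
  by apply/eqP; rewrite mulr0 oner_eq0.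
exists J, u, v; split=> // B B01.
have Wpos0 : \forall s \near 0^'+, 0 < W s by apply: filterS Wnear; exact: Wpos.
have [r /= r0 rB] := poincare_proj_cvg Xa W_0 Wpos0 B01.
(* As [T] is increasing, the times of [J] beyond [- e * T c] in the direction of
   [e] have parameters below [c], hence below the radius [r] given by [B]. *)
pose c := Num.min r b / 2.
have c0 : 0 < c by rewrite divr_gt0 // lt_min r0 b0.
have [cr cb] : c < r /\ c < b.
  by rewrite /c minEle; case: (leP r b) => ?; split; lra.
have cT : 0 < T c < T b by apply: TI; rewrite c0 cb.
have /andP[_ Tcb] := cT.
exists (- e * T c) => [|t Jt]; first exact: JI.
rewrite mulrA mulrN ee mulN1r ltrNl -mulNr => tc.
have tI : 0 < - e * t < T b by rewrite Jpos //= (lt_trans tc).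
have [/andP[g0 gb] Tg _] := sgP _ tI.
have [-> ->] := uvE t tI; apply: rB => //=.
rewrite sub0r normrN gtr0_norm // (lt_trans _ cr) // ltNge; apply/negP.
rewrite le_eqVlt => /orP[/eqP cg|/(Tlt _ _ (ltW c0) (ltW gb))].
  by move: tc; rewrite cg Tg ltxx.
by rewrite Tg ltNge (ltW tc).
Unshelve. all: by end_near. Qed.

Theorem lemma2p1 (R : realType) (m : nat) (P : 'I_m.+1 -> {poly R})
    (hP : P ord_max != 0)
    (hmono : monodromic_at_infinity 'X (\sum_(i < m.+1) P i *: 'X^i)) :
  (m <= 2)%N.
Proof.
rewrite leqNgt; apply/negP => m3.
have [e [e1 [J [u [v [Jmax Jend]]]]]] := newton_vertical_blowup m3 hP.
have [fwd bwd] := hmono J u v _ Jmax (newton_equilibrium (ltnW m3) hP).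
case: e1 Jend => -> Jend; [apply: fwd|apply: bwd] => B /Jend[s Js sB].
  by exists s => // t Jt st; apply: sB => //; rewrite !mul1r.
by exists s => // t Jt ts; apply: sB => //; rewrite !mulN1r ltrN2.
Qed.
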